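(* Let $k\ge1$ be an integer and let $\theta>0$. Then the function $\rho\mapsto\mathrm{effar}(k;\rho,\theta)$ is nondecreasing on $0<\rho<1$, and $$\mathrm{effar}(k;\rho,\theta)\le\theta+1\qquad\text{for all }0<\rho<1.$$
   Context: For $\rho\in(-1,1)$, $\theta\ge0$ and integer $k\ge1$, define $$\mathrm{effar}(k;\rho,\theta)=\frac{1+\theta}{k+\theta}\cdot\frac{1+\rho}{1-\rho}\cdot\frac{1-\rho^k}{1+\rho^k}.$$ (This is the efficiency of thinning a Markov chain sample by factor $k$ relative to no thinning when the autocorrelations are $\rho_\ell=\rho^\ell$, advancing the chain costs $1$ and evaluating the function costs $\theta$.) *)

(* Defs.v *)
From mathcomp Require Import all_boot all_order all_algebra.
From mathcomp Require Import reals.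

Set Implicit Arguments.
Unset Strict Implicit.
Unset Printing Implicit Defensive.

Import Order.TTheory GRing.Theory Num.Theory.
Local Open Scope ring_scope.

(* Intended for 1 <= k, -1 < rho < 1 and 0 <= theta, where no denominator
   vanishes. *)
Definition effar (R : realType) (k : nat) (rho theta : R) : R :=
  (1 + theta) / (k%:R + theta)
  * ((1 + rho) / (1 - rho))
  * ((1 - rho ^+ k) / (1 + rho ^+ k)).

(* Main.v *)
(* Since [(1 - rho^k) / (1 - rho) = \sum_(i < k) rho^i], the part of [effar]
   depending on [rho] is [\sum_(i < k) (rho^i + rho^(k-i)) / (1 + rho^k)].
   Each summand is nondecreasing on [0, 1] and equals 1 at [rho = 1], so the
   sum is nondecreasing and at most [k]; the bound then follows from
   [k / (k + theta) <= 1]. *)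
Require Import Defs.
From mathcomp Require Import all_boot all_order all_algebra.
From mathcomp Require Import reals.
From mathcomp Require Import ring.

Set Implicit Arguments.
Unset Strict Implicit.
Unset Printing Implicit Defensive.

Import Order.TTheory GRing.Theory Num.Theory.
Local Open Scope ring_scope.

(** After cross-multiplication the difference of the two sides splits into two products whose
    factors are all nonnegative on [0, 1]. *)
Lemma ler_addX_ratio (R : realFieldType) (i j : nat) (x y : R) :
  0 <= x -> x <= y -> y <= 1 ->
  (x ^+ i + x ^+ j) / (1 + x ^+ (i + j)) <=
  (y ^+ i + y ^+ j) / (1 + y ^+ (i + j)).
Proof.
move=> x0 xy y1.
have y0 := le_trans x0 xy; have x1 := le_trans xy y1.
have le_xyX n : x ^+ n <= y ^+ n by rewrite lerXn2r.
have den_gt0 z n : 0 <= z -> 0 < 1 + z ^+ n :> R.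
  by move=> z0; rewrite ltr_wpDr ?exprn_ge0.
rewrite ler_pdivrMr ?den_gt0// mulrAC ler_pdivlMr ?den_gt0// !exprD -subr_ge0.
rewrite [leRHS](_ : _ = (y ^+ i - x ^+ i) * (1 - x ^+ j * y ^+ j)
                      + (y ^+ j - x ^+ j) * (1 - x ^+ i * y ^+ i)); last by ring.
by rewrite addr_ge0// mulr_ge0// subr_ge0// mulr_ile1 ?exprn_ge0 ?exprn_ile1.
Qed.

(** The exponent [k] is kept as [i + (k - i)] so that each summand has the shape required by
    [ler_addX_ratio]. *)
Lemma geometric_ratioE (R : realFieldType) (k : nat) (x : R) :
  0 < x < 1 ->
  (1 + x) / (1 - x) * ((1 - x ^+ k) / (1 + x ^+ k)) =
  \sum_(i < k) (x ^+ i + x ^+ (k - i)) / (1 + x ^+ (i + (k - i))).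
Proof.
move=> /andP[x0 x1].
have -> : 1 - x ^+ k = (1 - x) * \sum_(i < k) x ^+ i.
  by rewrite -opprB subrX1 -mulNr opprB.
have -> : \sum_(i < k) (x ^+ i + x ^+ (k - i)) / (1 + x ^+ (i + (k - i))) =
          (\sum_(i < k) x ^+ i + \sum_(i < k) x ^+ (k - i)) / (1 + x ^+ k).
  rewrite -big_split/= mulr_suml; apply: eq_bigr => i _.
  by rewrite subnKC// ltnW.
(* Reversal sends [i] to [k - i.+1], so the exponent [k - i] becomes [i.+1]; this sum supplies the
   [x] part of the factor [1 + x]. *)
have -> : \sum_(i < k) x ^+ (k - i) = x * \sum_(i < k) x ^+ i.
  rewrite (reindex_inj rev_ord_inj)/= mulr_sumr; apply: eq_bigr => i _.
  by rewrite subKn// exprS.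
have xk_gt0 : 0 < x ^+ k by rewrite exprn_gt0.
by field; rewrite !gt_eqF ?subr_gt0 ?addr_gt0.
Qed.

Theorem theorem3 (R : realType) (k : nat) (theta : R)
    (k_ge1 : (1 <= k)%N) (theta_gt0 : 0 < theta) :
  {in `]0, 1[ &, {homo (fun rho : R => effar k rho theta) :
                    x y / x <= y}}
  /\ (forall rho : R, 0 < rho < 1 -> effar k rho theta <= theta + 1).
Proof.
have k_theta_gt0 : 0 < k%:R + theta by rewrite ltr_wpDl.
have c_ge0 : 0 <= (1 + theta) / (k%:R + theta).
  by rewrite divr_ge0 ?ltW// addr_gt0.
split=> [x y | rho rho01].
  rewrite !in_itv/= => x01 y01 xy; rewrite /effar -2![_ / (k%:R + _) * _ * _]mulrA.
  rewrite !geometric_ratioE// ler_wpM2l//; apply: ler_sum => i _.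
  by case/andP: x01 y01 => ? _ /andP[_ ?]; apply: ler_addX_ratio => //; exact: ltW.
rewrite /effar -mulrA geometric_ratioE//.
have sum_le : \sum_(i < k) (rho ^+ i + rho ^+ (k - i)) /
                (1 + rho ^+ (i + (k - i))) <= k%:R.
  rewrite -[leRHS]mulr1 mulr_natl -[in leRHS](card_ord k) -sumr_const.
  apply: ler_sum => i _; case/andP: rho01 => rho0 rho1.
  (* Compare with the endpoint 1: unlike the quotient by [1 - rho], the summand is well defined
     there, with value 2/2. *)
  apply: le_trans (ler_addX_ratio _ _ (ltW rho0) (ltW rho1) (lexx _)) _.
  by rewrite !expr1n divff// lt0r_neq0// addr_gt0.
apply: le_trans (ler_wpM2l c_ge0 sum_le) _.
by rewrite mulrAC ler_pdivrMr// addrC ler_wpM2l ?lerDl ?addr_ge0 ?ltW.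
Qed.
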